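(* Let $r\ge 2$ be an integer and let $n$ be a proper multiple of $r$ (i.e. $n=kr$ for some integer $k\ge 2$). Then there exists $G\in\mathcal{M}_{1/r}(\mathcal{C})$ with $v(G)=n$, and in fact such $G$ can be chosen planar. In particular, $\mathcal{M}_{1/r}(\mathcal{C})$ contains infinitely many pairwise non-isomorphic planar graphs.
   Context: All graphs are finite and simple; $v(G)$ denotes the number of vertices of $G$. For an integer $r\ge2$, $\mathcal{R}_{1/r}(\mathcal{C})$ denotes the class of graphs $G$ such that every colouring of $E(G)$ with $r+1$ colours admits a cycle in $G$ (of arbitrary length) whose edges use at most $r$ of the colours. $\mathcal{M}_{1/r}(\mathcal{C})$ is the class of those $G\in\mathcal{R}_{1/r}(\mathcal{C})$ that are minimal with respect to the subgraph relation, i.e. no proper subgraph of $G$ belongs to $\mathcal{R}_{1/r}(\mathcal{C})$. *)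

(* Defs.v *)
From mathcomp Require Import all_boot all_order all_algebra.
From mathcomp Require Import boolp classical_sets reals topology normedtype.

Set Implicit Arguments.
Unset Strict Implicit.
Unset Printing Implicit Defensive.

Import Order.TTheory GRing.Theory Num.Theory.
Import numFieldNormedType.Exports.

Record sgraph := SGraph {
  svertex :> finType;
  adj : rel svertex;
  adj_sym : symmetric adj;
  adj_irr : irreflexive adj }.

Definition edges (G : sgraph) : {set {set G}} :=
  [set e | [exists x : G, exists y : G, adj x y && (e == [set x; y])]].

Definition is_cycle (G : sgraph) (s : seq G) : bool :=
  [&& 2 < size s, path.cycle (@adj G) s & uniq s].

Definition cycle_edges (G : sgraph) (s : seq G) : {set {set G}} :=
  [set [set x; next s x] | x in s].

(* [in_R r] and [in_M r] are membership in R_{1/r}(C) and M_{1/r}(C).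
   A colouring of the edges is given as a function on all vertex sets; only
   its values on [edges G] matter, since cycles only use edges of G. *)
Definition in_R (r : nat) (G : sgraph) : Prop :=
  forall c : {set G} -> 'I_r.+1,
  exists2 s : seq G, is_cycle s & #|c @: cycle_edges s| <= r.

Record subgraph (G : sgraph) := SubGraph {
  sub_verts : {set G};
  sub_adj : rel G;
  sub_adj_sym : symmetric sub_adj;
  sub_adjP : forall x y, sub_adj x y ->
    [&& x \in sub_verts, y \in sub_verts & adj x y] }.

Section GraphOfSub.
Variables (G : sgraph) (H : subgraph G).

Let V : finType := {x : G | x \in sub_verts H}.
Let E : rel V := fun x y => sub_adj H (val x) (val y).

Fact graph_of_sub_sym : symmetric E.
Proof. by move=> x y; rewrite /E sub_adj_sym. Qed.

Fact graph_of_sub_irr : irreflexive E.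
Proof.
move=> x; apply/negbTE/negP => /sub_adjP/and3P[_ _].
by rewrite adj_irr.
Qed.

Definition graph_of_sub : sgraph := SGraph graph_of_sub_sym graph_of_sub_irr.
End GraphOfSub.

(* A proper subgraph may lack only vertices, only edges, or both. *)
Definition proper_subgraph (G : sgraph) (H : subgraph G) : Prop :=
  sub_verts H != [set: G] \/ exists x y : G, adj x y && ~~ sub_adj H x y.

Definition in_M (r : nat) (G : sgraph) : Prop :=
  in_R r G /\
  forall H : subgraph G, proper_subgraph H -> ~ in_R r (graph_of_sub H).

Definition isomorphic (G H : sgraph) : Prop :=
  exists2 f : G -> H, bijective f & forall x y, adj (f x) (f y) = adj x y.

Local Open Scope classical_set_scope.

Definition is_arc (R : realType) (p q : R * R) (A : set (R * R)) : Prop :=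
  exists f : R -> R * R,
    [/\ {within `[0%R, 1%R], continuous f},
        {in `[0%R, 1%R] &, injective f},
        f 0%R = p, f 1%R = q & f @` `[0%R, 1%R] = A].

(* Vertices are distinct points, edges are arcs between their ends, and the
   interior of an edge contains no vertex and no point of any other edge. *)
Definition planar (R : realType) (G : sgraph) : Prop :=
  exists (p : G -> R * R) (A : {set G} -> set (R * R)),
    [/\ injective p,
        forall x y : G, adj x y -> is_arc (p x) (p y) (A [set x; y]%SET),
        forall (e : {set G}) (z : G), e \in edges G -> A e (p z) -> z \in e
      & forall e e' : {set G}, e \in edges G -> e' \in edges G -> e != e' ->
          A e `&` A e' `<=` [set p z | z in [set` e]]].

(* Main.v *)
Require Import Defs.
From mathcomp Require Import all_boot all_order all_algebra.
From mathcomp Require Import boolp classical_sets reals topology normedtype.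
From mathcomp Require Import zify ring lra.

(* The witness on n = kr vertices is the cycle 0, ..., n-1 with the k-1 chords
   joining 0 to r, 2r, ..., (k-1)r.  It has k(r+1)-1 edges.  If every cycle saw
   all r+1 colours, deleting any one colour would leave a forest, so that
   r(k(r+1)-1) <= (r+1)(kr-1), which fails by 1.  Conversely, colour the cycle
   edge j, j+1 by j mod r and the chords by r: every cycle except the outer one
   sees all colours, which settles the deletion of a cycle edge; when the chord
   0, ir is deleted, recolour the edge ir-1, ir with r. *)

Set Implicit Arguments.
Unset Strict Implicit.
Unset Printing Implicit Defensive.

(** * Acyclicity by ranking, and the edge count of forests *)

Lemma next_neq_prev (T : eqType) (s : seq T) (x : T) :
  uniq s -> 2 < size s -> x \in s -> next s x != prev s x.
Proof.
move=> us ss xs; apply/eqP => eq_np.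
have : next s (next s x) = x by rewrite eq_np next_prev.
have [i t def] := rot_to xs.
rewrite -!(next_rot i us) def.
move: us ss; rewrite -(rot_uniq i) -(size_rot i) def.
case: t {def} => [|a [|b t]] //=.
rewrite !inE !negb_or !eqxx => /andP[/and3P[/negPf xa /negPf xb _] _] _.
by rewrite [a == x]eq_sym xa => bx; rewrite bx eqxx in xb.
Qed.

(** At a vertex of maximal rank on the cycle, both cycle neighbours have smaller rank and hence are
    its unique parent under [p], although they are distinct. *)
Lemma no_ranked_cycle (T : finType) (e : rel T) (f : T -> nat) (p : T -> T -> Prop)
    (s : seq T) :
  (forall x y z, p x y -> p x z -> y = z) ->
  (forall x y, e x y -> (f x < f y /\ p y x) \/ (f y < f x /\ p x y)) ->
  2 < size s -> uniq s -> path.cycle e s -> False.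
Proof.
move=> pfun ef ss us cs.
have [x0 x0s] : exists x, x \in s by case: s ss {us cs} => // x s; exists x; rewrite mem_head.
case: (arg_maxnP f x0s) => x xs xmax.
have := next_neq_prev us ss xs; rewrite (pfun x (next s x) (prev s x)) ?eqxx //.
- have ws : next s x \in s by rewrite mem_next.
  have /= := xmax _ ws.
  by case: (ef _ _ (next_cycle cs xs)) => -[flt pe] //; lia.
- have ws : prev s x \in s by rewrite mem_prev.
  have /= := xmax _ ws.
  by case: (ef _ _ (prev_cycle cs xs)) => -[flt pe] //; lia.
Qed.

Section Forest.
Variables (T : finType) (e : rel T).
Hypotheses (e_sym : symmetric e) (e_irr : irreflexive e).

(** Extend a path at its head: of two neighbours in [A], one is not the second vertex of the path,
    and it is either new or closes a cycle. *)
Lemma cycle_or_long_path (A : {set T}) : A != finset.set0 ->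
  (forall x, x \in A -> 1 < \sum_(y in A) e x y) ->
  (exists s, [/\ 2 < size s, uniq s & path.cycle e s]) \/
  forall m, exists x p, [/\ path e x p, uniq (x :: p), {subset x :: p <= A} & size p = m].
Proof.
move=> /set0Pn[a aA] deg.
have [|nocyc] := pselect (exists s, [/\ 2 < size s, uniq s & path.cycle e s]); first by left.
right; elim=> [|m [x [p [px up pA szp]]]].
  by exists a, [::]; split=> // y; rewrite inE => /eqP->.
have := deg x (pA _ (mem_head _ _)).
have -> : \sum_(y in A) e x y = #|[set y in A | e x y]|.
  rewrite -sum1_card big_mkcond [RHS]big_mkcond /=.
  by apply: eq_bigr => y _; rewrite inE; case: (y \in A); case: e.
move=> /card_gt1P[y [z []]]; rewrite !inE => /andP[yA xy] /andP[zA xz] yz.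
(* For empty [p] the default [x] excludes nothing, since no vertex is its own neighbour. *)
have ext w : w \in A -> e x w -> w != head x p ->
   exists x p, [/\ path e x p, uniq (x :: p), {subset x :: p <= A} & size p = m.+1].
  move=> wA xw whd.
  have wx : w != x by apply: contraTneq xw => ->; rewrite e_irr.
  have [wp|wp] := boolP (w \in p); last first.
    exists w, (x :: p); split => //=.
    - by rewrite e_sym xw.
    - by move: up => /= ->; rewrite inE negb_or wx wp.
    - by move=> u; rewrite inE => /predU1P[->|/pA].
    - by rewrite szp.
  exfalso; apply: nocyc.
  case/splitPr: wp whd px up {szp pA} => p1 p2 whd.
  rewrite -cat_rcons cat_path => /andP[px _].
  rewrite -cat_cons cat_uniq => /andP[up _].
  exists (x :: rcons p1 w); split=> //.
  - by case: p1 whd {px up} => [|? ?] //=; rewrite ?eqxx // size_rcons.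
  - by rewrite /= rcons_path px last_rcons e_sym.
have [yh|yh] := eqVneq y (head x p); last exact: (ext y).
by apply: (ext z) => //; rewrite -yh eq_sym.
Qed.

(** Some vertex has degree at most 1, as otherwise paths would outgrow [T]; removing it costs at
    most one edge. The sum runs over ordered pairs, which doubles the usual bound. *)
Lemma forest_pairs : (forall s, 2 < size s -> uniq s -> path.cycle e s -> False) ->
  \sum_x \sum_y e x y <= 2 * #|T|.-1.
Proof.
move=> acyc.
suff main n (A : {set T}) : #|A| = n -> \sum_(x in A) \sum_(y in A) e x y <= 2 * n.-1.
  have := main _ [set: T]%SET erefl; rewrite cardsT.
  under eq_bigr do under eq_bigl do rewrite finset.in_setT.
  by under eq_bigl do rewrite finset.in_setT.
elim: n A => [|n IH] A cA.
  by rewrite big1 // => x; rewrite (cards0_eq cA) inE.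
have [x xA dx] : exists2 x, x \in A & \sum_(y in A) e x y <= 1.
  apply: contrapT => H.
  have A0 : A != finset.set0 by rewrite -card_gt0 cA.
  have [x xA|[s [? ? ?]]|/(_ #|T|)[x [p [_ up _ sp]]]] := @cycle_or_long_path A A0.
  - by rewrite ltnNge; apply/negP => h; apply: H; exists x.
  - by case: (acyc s).
  - by have := max_card (mem (x :: p)); rewrite (card_uniqP up) /= sp ltnn.
have cB : #|A :\ x| = n by move: cA; rewrite (cardsD1 x) xA => -[].
have eB : \sum_(z in A :\ x) e z x = \sum_(y in A) e x y.
  by rewrite [RHS](big_setD1 x) //= e_irr; apply: eq_bigr => z _; rewrite e_sym.
rewrite (big_setD1 x) //=.
under [X in _ + X]eq_bigr do rewrite (big_setD1 x) //=.
rewrite big_split /= eB.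
(* If [x] is the only vertex left, the predecessor truncates and degree at most 1 is too weak; the
   degree is then 0. *)
have := IH _ cB; case: n cB {IH cA} => [/cards0_eq B0 _|n cB]; last by lia.
by rewrite -eB B0 !big_set0.
Qed.
End Forest.

(** * Criteria for lying inside or outside R_{1/r}(C) *)

(** If every cycle sees all colours, the edges avoiding a colour [d] form a forest. Each edge avoids
    exactly [r] colours, so summing [forest_pairs] over [d] bounds the edge count. *)
Lemma in_R_of_dense (r : nat) (G : sgraph) :
  r.+1 * (2 * #|G|.-1) < r * \sum_(x : G) \sum_(y : G) adj x y -> in_R r G.
Proof.
move=> dense c.
have [//|nocyc] := pselect (exists2 s : seq G, is_cycle s & #|c @: cycle_edges s| <= r).
exfalso; move: dense; rewrite ltnNge => /negP; apply.
pose e d : rel G := fun x y => adj x y && (c [set x; y] != d).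
have -> : r * \sum_(x : G) \sum_(y : G) adj x y = \sum_(d : 'I_r.+1) \sum_x \sum_y e d x y.
  rewrite [RHS]exchange_big /= big_distrr /=; apply: eq_bigr => x _.
  rewrite [RHS]exchange_big /= big_distrr /=; apply: eq_bigr => y _.
  rewrite /e; case: (adj x y) => /=; last by rewrite big1 // muln0.
  rewrite muln1 -[LHS]/(r.+1.-1) -[in LHS](card_ord r.+1) -(cardC1 (c [set x; y])) -sum1_card.
  rewrite big_mkcond /=; apply: eq_bigr => d _.
  by rewrite !inE eq_sym; case: eqP.
rewrite -[X in X * _](card_ord r.+1) -sum_nat_const; apply: leq_sum => d _.
apply: forest_pairs => [x y|x|s ss us cs].
- by rewrite /e adj_sym finset.setUC.
- by rewrite /e adj_irr.
apply: nocyc; exists s.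
  by rewrite /is_cycle ss us andbT /=; apply: sub_cycle cs => x y /andP[].
rewrite -ltnS -[X in _ < X](card_ord r.+1) -cardsT; apply: proper_card.
rewrite properT; apply/negP => /eqP/setP/(_ d); rewrite inE.
move=> /imsetP[E /imsetP[x xs ->] dE].
by have := next_cycle cs xs; rewrite /e -dE eqxx andbF.
Qed.

(** Bridges symmetric functions of two vertices, in which colourings are built below, and the
    functions of vertex sets in [in_R]. *)
Lemma pair_function_factors (T : finType) (C : Type) (g : T -> T -> C) :
  (forall x y, g x y = g y x) -> inhabited C ->
  exists c : {set T} -> C, forall x y, c [set x; y] = g x y.
Proof.
move=> gsym [c0].
exists (fun e => if [pick p : T * T | e == [set p.1; p.2]] is Some p then g p.1 p.2 else c0).
move=> x y; case: pickP => [[a b] /= /eqP eab|/(_ (x, y))]; last by rewrite eqxx.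
have := set21 x y; have := set22 x y; rewrite {1 2}eab !inE.
have := set21 a b; have := set22 a b; rewrite -{1 2}eab !inE.
by do 4![move=> /orP[]/eqP ?]; subst.
Qed.

(** A cycle that misses colour [d] survives the deletion of all edges of colour [d]. *)
Lemma not_in_R_of_acyclic (r : nat) (G : sgraph) (g : G -> G -> 'I_r.+1) :
  (forall x y, g x y = g y x) ->
  (forall d s, 2 < size s -> uniq s ->
     path.cycle (fun x y => adj x y && (g x y != d)) s -> False) ->
  ~ in_R r G.
Proof.
move=> gsym acyc inR.
have [c cE] := pair_function_factors gsym (inhabits ord0).
have [s /and3P[ss cs us]] := inR c.
rewrite leqNgt => /negP; apply.
suff -> : c @: cycle_edges s = [set: _]%SET by rewrite cardsT card_ord.
apply/setP => d; rewrite inE; apply/negPn/negP => dN.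
apply: (acyc d s ss us).
apply: cycle_from_next => // x xs; rewrite (next_cycle cs xs) /=.
apply: contra dN => /eqP <-; rewrite -cE; apply: imset_f; exact: imset_f.
Qed.

(** * The fan and its number of edges *)

(* The fan is the cycle 0, 1, ..., n-1 together with the chords from 0 to the
   multiples of r; [fan_up] lists its edges x y with x < y. *)
Definition fan_up (n r x y : nat) : bool :=
  (y == x.+1) || [&& x == 0, 0 < y & (y == n.-1) || (r %| y)].

Lemma fan_up_lt n r x y : fan_up n r x y -> x < y.
Proof. by case/orP=> [/eqP->|/and3P[/eqP->]]. Qed.

Definition fan_adj (n r : nat) : rel 'I_n :=
  fun x y => fan_up n r x y || fan_up n r y x.

Fact fan_sym n r : symmetric (@fan_adj n r).
Proof. by move=> x y; rewrite /fan_adj orbC. Qed.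

Fact fan_irr n r : irreflexive (@fan_adj n r).
Proof. by move=> x; apply/negP; rewrite /fan_adj orbb => /fan_up_lt; rewrite ltnn. Qed.

Definition fan (n r : nat) : sgraph := SGraph (@fan_sym n r) (@fan_irr n r).

Lemma fan_up_degree k r (x : 'I_(k * r)) : 1 < k -> 1 < r ->
  (x < (k * r).-1) + k * (x == 0 :> nat) <= \sum_(y < k * r) fan_up (k * r) r x y.
Proof.
move=> k1 r1; set n := k * r.
have -> : \sum_(y < n) fan_up n r x y = #|[set y : 'I_n | fan_up n r x y]%SET|.
  rewrite -sum1_card [RHS]big_mkcond /=.
  by apply: eq_bigr => y _; rewrite inE; case: fan_up.
have [x0|x0] /= := eqVneq (x : nat) 0; last first.
  rewrite muln0 addn0; case: ltnP => //= xn.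
  have yn : x.+1 < n by rewrite -ltn_predRL.
  by apply/card_gt0P; exists (Ordinal yn); rewrite inE /fan_up /= eqxx.
have n4 : 2 * 2 <= n by apply: leq_mul.
(* The k+1 upper neighbours of 0: its successor, the last vertex and the k-1 chord ends. They are
   distinct because [1 < r]. *)
pose h i := if i == 0 then 1 else if i == k then n.-1 else i * r.
have hn (i : 'I_k.+1) : h i < n.
  rewrite /h; have := ltn_ord i; case: eqP => [|_]; first by lia.
  by case: eqP; rewrite /n; nia.
have hinj : {in gtn k.+1 &, injective h}.
  move=> i j; rewrite !inE /h => ik jk.
  have B m : m != 0 -> m < k -> 1 < m * r < n.-1 by rewrite /n; nia.
  move: (B i) (B j); case: (eqVneq i 0) => [->|i0] Bi; case: (eqVneq j 0) => [->|j0] Bj //.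
  - by case: (eqVneq j k) => jk'; first lia; have := Bj isT; lia.
  - by case: (eqVneq i k) => ik'; first lia; have := Bi isT; lia.
  case: (eqVneq i k) => [->|ik']; case: (eqVneq j k) => [->|jk'] //.
  - by have := Bj isT; lia.
  - by have := Bi isT; lia.
  by move/eqP; rewrite eqn_pmul2r; [move/eqP|lia].
have xn : x < n.-1 by lia.
rewrite xn muln1 add1n -[X in X <= _](card_ord k.+1).
pose F i : 'I_n := Ordinal (hn i).
have Finj : injective F.
  move=> i j /(congr1 val) /= hij; apply: val_inj; apply: hinj => //; exact: ltn_ord.
rewrite -(card_imset _ Finj); apply: subset_leq_card; apply/fintype.subsetP => y /imsetP[i _ ->].
rewrite inE /fan_up /= /h x0; case: (eqVneq (i : nat) 0) => //= i0.
case: (eqVneq (i : nat) k) => [_|ik]; first by rewrite eqxx; apply/orP; right; lia.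
by rewrite dvdn_mull ?orbT ?andbT //; nia.
Qed.

Lemma fan_in_R k r : 1 < k -> 1 < r -> in_R r (fan (k * r) r).
Proof.
move=> k1 r1; apply: in_R_of_dense; rewrite card_ord.
have split_adj (x y : fan (k * r) r) :
    (adj x y : nat) = fan_up (k * r) r x y + fan_up (k * r) r y x.
  rewrite /= /fan_adj; case xy: (fan_up _ _ x y); case yx: (fan_up _ _ y x) => //.
  by have := fan_up_lt xy; have := fan_up_lt yx; lia.
under eq_bigr do under eq_bigr do rewrite split_adj.
under eq_bigr do rewrite big_split /=.
rewrite big_split /= [X in _ + X]exchange_big /= addnn.
have : k + (k * r).-1 <= \sum_(x < k * r) \sum_(y < k * r) fan_up (k * r) r x y.
  apply: (@leq_trans (\sum_(x < k * r) ((x < (k * r).-1) + k * (x == 0 :> nat)))); last first.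
    by apply: leq_sum => x _; apply: fan_up_degree.
  have : 0 < k * r by nia.
  case: (k * r) => // m _; rewrite big_split /= big_ord_recr /= ltnn addn0.
  rewrite [X in _ <= _ + X]big_ord_recl /= muln1 [k + _]addnC.
  rewrite leq_add ?leq_addr //.
  by under eq_bigr do rewrite ltn_ord; rewrite sum_nat_const card_ord muln1.
set S := \sum_(x < _) _; move=> leS.
have n0 : 0 < k * r by nia.
have : r * (k + (k * r).-1) <= r * S by rewrite leq_mul2l leS orbT.
(* With rk = n, and up to a factor 2, the right side is at least r(n-1) + n, one more than
   (r+1)(n-1). *)
rewrite -muln2; move: (k * r) n0 (mulnC k r) => n n0 nE.
rewrite mulnDr -nE; case: n n0 {nE leS} => //= m _; lia.
Qed.

(** * Colourings of the fan without one edge *)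

(* A deleted chord 0 w is compensated by giving the cycle edge w-1, w the chord
   colour r; if a cycle edge is deleted, w = 0 and nothing is recoloured. *)
Definition fan_colour (n r w x y : nat) : nat :=
  if y == x.+1 then (if y == w then r else x %% r)
  else if (x == 0) && (y == n.-1) then r.-1 else r.

(* If every edge of a graph satisfies [climbs f p], then all neighbours of a vertex
   x other than p x have larger rank f, so the graph is acyclic: look at a
   vertex of maximal rank on a cycle. *)
Definition climbs (f p : nat -> nat) (x y : nat) : Prop :=
  (f x < f y /\ p y = x) \/ (f y < f x /\ p x = y).

Lemma modnS_cases r x : 0 < r ->
  (x %% r = r.-1 /\ x.+1 %% r = 0) \/ (x %% r < r.-1 /\ x.+1 %% r = (x %% r).+1).
Proof.
move=> r0; have := ltn_pmod x r0; have := ltn_pmod x.+1 r0; rewrite modnS.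
case: ifP => [|_]; last by lia.
rewrite /dvdn -addn1 -modnDml addn1 => /eqP + _ lt.
case: (eqVneq (x %% r) r.-1); first by lia.
by move=> ne; rewrite modn_small; lia.
Qed.

Lemma modn_pred_mul k r : 0 < k -> 0 < r -> (k * r).-1 %% r = r.-1.
Proof.
move=> k0 r0; have := modnS_cases (k * r).-1 r0; rewrite prednK ?modnMl; first lia.
by rewrite muln_gt0 k0.
Qed.

(* Removing the cycle edges of colour d splits the cycle into blocks that contain
   one multiple of r each; the rank is the distance to that multiple, shifted
   by 1 for the step to 0. *)
Lemma fan_climbs_low k r w d x y : 1 < k -> 1 < r -> r %| w -> d < r.-1 ->
  x < y < k * r -> fan_up (k * r) r x y -> fan_colour (k * r) r w x y != d ->
  climbs (fun x => if x == 0 then 0 else if x %% r <= d then (x %% r).+1 else (r - x %% r).+1)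
    (fun x => if x %% r == 0 then 0 else if x %% r <= d then x.-1
              else if x == (k * r).-1 then 0 else x.+1) x y.
Proof.
move=> k1 r1 rw dr /andP[xy yn]; rewrite /fan_up /fan_colour /climbs /dvdn => up col.
have r0 : 0 < r by lia.
have n0 : 2 * 2 <= k * r by apply: leq_mul.
have nE : (k * r).-1 %% r = r.-1 by apply: modn_pred_mul; lia.
have x0r : x = 0 -> x %% r = 0 by move=> ->; rewrite mod0n.
move: (k * r) n0 nE yn up col => n n0 nE yn up col.
have ynr : y = n.-1 -> y %% r = r.-1 by move=> ->.
have [yx|yx] := eqVneq y x.+1.
  have {}col : x %% r != d.
    move: col; rewrite yx eqxx; case: (eqVneq x.+1 w) => // xw _.
    (* A recoloured edge ends at a multiple of [r], so [x] has residue [r.-1], which exceeds [d]. *)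
    by have := modnS_cases x r0; rewrite xw (eqP rw); lia.
  have := modnS_cases x r0; rewrite -yx => xyr.
  clear up ynr nE n0 xy rw k1 k.
  move: (x %% r) (y %% r) col xyr x0r => mx my /eqP col xyr x0r.
  have -> : (y == 0) = false by lia.
  have -> : (x == n.-1) = false by lia.
  case: xyr => [[mxE myE]|[mxE myE]].
    have -> : (x == 0) = false by lia.
    have -> : (mx <= d) = false by lia.
    have -> : (mx == 0) = false by lia.
    by right; rewrite myE /=; lia.
  have -> : (my == 0) = false by lia.
  (* As [mx] is not [d], the two consecutive residues lie on the same side of [d]. *)
  have -> : (my <= d) = (mx <= d) by lia.
  case: (leqP mx d) => mxd; first by left; case: (x == 0); lia.
  have -> : (x == 0) = false by lia.
  have -> : (mx == 0) = false by lia.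
  by right; lia.
(* Only edges at 0 remain. The last vertex has residue [r.-1], above [d], so its parent is 0. *)
move: up; rewrite (negPf yx) /= => /and3P[/eqP-> y_gt0 up].
left; rewrite eqxx (gtn_eqF y_gt0); split; first by case: ifP.
case: (eqVneq (y %% r) 0) => //= yr.
by move: up; rewrite /dvdn (negPf yr) orbF => /eqP yE; rewrite ynr // yE eqxx leqNgt dr.
Qed.

(** Without colour [r.-1], paths run upwards from the multiples of [r], each hanging on 0 by its
    chord. Only [w] has lost its chord; it hangs on its predecessor by the recoloured edge. *)
Lemma fan_climbs_pred n r w x y : 1 < r -> fan_up n r x y ->
  ~ (x = 0 /\ y = w) -> fan_colour n r w x y != r.-1 ->
  climbs id (fun x => if (x %% r == 0) && (x != w) then 0 else x.-1) x y.
Proof.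
move=> r1 up xyw col; left; split; first exact: fan_up_lt up.
move: up col; rewrite /fan_up /fan_colour; have [-> _|yx] /= := eqVneq y x.+1.
  case: (eqVneq x.+1 w) => xw col; first by rewrite andbF.
  by have := @modnS_cases r x; case: ifP => /=; lia.
move=> /and3P[/eqP x0 y0]; rewrite x0 eqxx /=; case: (eqVneq y n.-1) => [_ _|_] /=.
  by rewrite eqxx.
rewrite /dvdn => -> _; case: eqVneq => //= yw.
by case: xyw.
Qed.

(* What remains besides the cycle edge leaving g is a path, ranked from g + 1. *)
Lemma fan_climbs_rot n r w g x y : 1 < r -> 2 < n -> x < y < n -> fan_up n r x y ->
  g < n -> (y = x.+1 -> y != w -> x != g) -> (x = 0 -> y = n.-1 -> g != n.-1) ->
  fan_colour n r w x y != r ->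
  climbs (fun x => if g < x then x - g.+1 else x + n - g.+1)
         (fun x => if x == 0 then n.-1 else x.-1) x y.
Proof.
move=> r1 n2 /andP[xy yn] up gn step wrap.
rewrite /fan_colour /climbs; have [yx|yx] := eqVneq y x.+1.
  case: (eqVneq y w) => [|yw _]; first by rewrite eqxx.
  have := step yx yw; case: (ltnP g x) => ?; case: (ltnP g y) => ?;
    case: (eqVneq x 0) => ?; case: (eqVneq y 0) => ?; lia.
case: ifP => [/andP[/eqP x0 /eqP yE] _|_]; last by rewrite eqxx.
have := wrap x0 yE; case: (ltnP g x) => ?; case: (ltnP g y) => ?;
    case: (eqVneq x 0) => ?; case: (eqVneq y 0) => ?; lia.
Qed.

(** The recolouring [w] depends only on the missing edge [a b], the ranking also on the deleted
    colour [d]: colours below [r.-1], [r.-1] itself and [r] need different rankings. *)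
Lemma fan_climbs k r a b : 1 < k -> 1 < r -> b < k * r -> fan_up (k * r) r a b ->
  exists w, forall d, d <= r -> exists f p, forall x y,
    x < y < k * r -> fan_up (k * r) r x y -> ~ (x = a /\ y = b) ->
    fan_colour (k * r) r w x y != d -> climbs f p x y.
Proof.
move=> k1 r1 bn ab; have r0 : 0 < r by lia.
have n0 : 2 * 2 <= k * r by apply: leq_mul.
have lt_ab := fan_up_lt ab.
pose outer := (b == a.+1) || ((a == 0) && (b == (k * r).-1)).
pose w := if outer then 0 else b.
have rw : r %| w.
  rewrite /w; case: ifP => [_|]; first exact: dvdn0.
  move: ab; rewrite /fan_up /outer; case: eqVneq => //= _ /and3P[/eqP-> _].
  by rewrite eqxx /=; case: eqP.
have a0 : ~~ outer -> a = 0.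
  by move: ab; rewrite /fan_up /outer; case: eqVneq => //= _ /and3P[/eqP].
exists w => d dr.
have [ltd|led] := ltnP d r.-1.
  by do 2!eexists; move=> x y xyn up _; apply: fan_climbs_low ltd xyn up.
have [->|d_r] := eqVneq d r.-1.
  do 2!eexists; move=> x y xyn up xyab; apply: fan_climbs_pred => // -[x0 yw].
  by apply: xyab; move: yw a0; rewrite /w; case: ifP; lia.
have -> : d = r by lia.
(* Without colour [r] the outer cycle has a gap after [g]: the missing edge if it lies on that
   cycle, else the recoloured edge from [b.-1] to [b]. *)
pose g := if outer then (if b == a.+1 then a else (k * r).-1) else b.-1.
do 2!eexists; move=> x y xyn up xyab; apply: (fan_climbs_rot (g := g)) => //; first lia.
- by rewrite /g; case: ifP => _; first case: ifP; lia.
- move=> yx; rewrite /g /w; case: ifP => _; last by lia.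
  case: (eqVneq b a.+1) => [ba _|_ _]; last by lia.
  by apply/eqP => xa; apply: xyab; lia.
- move=> x0 yE; rewrite /g; case: (boolP outer) => [out|_]; last by lia.
  by move: out; rewrite /outer; case: (eqVneq b a.+1) => /= [_ _|_ /andP[/eqP a0' /eqP bE]]; lia.
Qed.

Lemma fan_colour_le n r w x y : 0 < r -> fan_colour n r w x y <= r.
Proof.
move=> r0; rewrite /fan_colour; have := ltn_pmod x r0.
by do 3?[case: ifP => _]; lia.
Qed.

(** * Minimality of the fan *)

(** A missing vertex takes along the cycle edge to its successor, or to its predecessor if it is the
    last vertex. *)
Lemma fan_proper_missing_edge n r (H : subgraph (fan n r)) : 2 < n ->
  proper_subgraph H -> exists a b : 'I_n, fan_up n r a b /\ ~~ sub_adj H a b.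
Proof.
move=> n2 [HV|[x [y /andP[/= /orP[xy|yx] nH]]]]; last 2 first.
- by exists x, y.
- by exists y, x; rewrite sub_adj_sym.
have [v _ vH] : exists2 v : fan n r, v \in [set: fan n r]%SET & v \notin sub_verts H.
  by apply/subsetPn; rewrite finset.subTset.
have noadj u : ~~ sub_adj H v u by apply: contra vH => /sub_adjP/and3P[].
have [vn|vn] := ltnP v.+1 n.
  by exists v, (Ordinal vn); rewrite /fan_up /= eqxx.
have un : n.-2 < n by lia.
exists (Ordinal un), v; rewrite sub_adj_sym noadj /fan_up /=; split=> //.
by have := ltn_ord v; lia.
Qed.

(** Since [climbs] is a condition on single edges, it holds in every subgraph without [a b],
    whatever else is missing. *)
Lemma fan_proper_not_in_R k r (H : subgraph (fan (k * r) r)) : 1 < k -> 1 < r ->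
  proper_subgraph H -> ~ in_R r (graph_of_sub H).
Proof.
move=> k1 r1 Hproper; have n0 : 2 * 2 <= k * r by apply: leq_mul.
have r0 : 0 < r by lia.
have [a [b [ab abH]]] := fan_proper_missing_edge (leq_trans (isT : 2 < 2 * 2) n0) Hproper.
have [w wP] := fan_climbs k1 r1 (ltn_ord b) ab.
pose nat_of (x : graph_of_sub H) : nat := \val (\val x).
(* Minimum and maximum make the colouring symmetric, as [fan_colour] expects the smaller end
   first. *)
pose col (x y : graph_of_sub H) : 'I_r.+1 :=
  inord (fan_colour (k * r) r w (minn (nat_of x) (nat_of y)) (maxn (nat_of x) (nat_of y))).
apply: (@not_in_R_of_acyclic _ _ col) => [x y|d s ss us cs].
  by rewrite /col minnC maxnC.
have [f [p fp]] := wP d (ltn_ord d).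
pose p' x y := p (nat_of x) = nat_of y.
apply: (@no_ranked_cycle _ _ (f \o nat_of) p' s _ _ ss us cs) => [x y z|x y].
  by rewrite /p' => -> /val_inj/val_inj.
suff main u v : fan_up (k * r) r (nat_of u) (nat_of v) -> adj u v -> col u v != d ->
    climbs f p (nat_of u) (nat_of v).
  move=> /andP[xy cxy]; have /sub_adjP/and3P[_ _ /= /orP[up|up]] := xy.
    by have := main x y up xy cxy.
  by move: xy cxy; rewrite adj_sym /col minnC maxnC => yx cyx; have [] := main y x up yx cyx; auto.
move=> up uv cuv; have lt_uv := fan_up_lt up.
apply: fp => //.
- by rewrite lt_uv /=; apply: ltn_ord.
- move=> [ua vb]; case/negP: abH.
  by rewrite -(val_inj ua : \val u = a) -(val_inj vb : \val v = b).
apply: contra cuv => /eqP cd; apply/eqP/val_inj.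
by rewrite /col (minn_idPl (ltnW lt_uv)) (maxn_idPr (ltnW lt_uv)) /= inordK ?ltnS ?fan_colour_le.
Qed.

Lemma fan_in_M k r : 1 < k -> 1 < r -> in_M r (fan (k * r) r).
Proof.
by move=> k1 r1; split=> [|H]; [exact: fan_in_R | exact: fan_proper_not_in_R].
Qed.

(** * A straight-line drawing of the fan *)

Import Order.TTheory GRing.Theory Num.Theory.
Import numFieldNormedType.Exports.

Section Planarity.
Variable R : realType.
Local Open Scope ring_scope.
Local Open Scope classical_set_scope.

Definition line (P Q : R * R) (t : R) : R * R :=
  (P.1 + t * (Q.1 - P.1), P.2 + t * (Q.2 - P.2)).

Definition segment (P Q : R * R) : set (R * R) := line P Q @` `[0, 1].

Lemma segmentC P Q : segment P Q = segment Q P.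
Proof.
suff sub A B : segment A B `<=` segment B A by apply/seteqP; split; apply: sub.
move=> _ [t /= t01 <-]; exists (1 - t).
  by move: t01; rewrite /= !in_itv /=; lra.
by rewrite /line; congr pair; ring.
Qed.

Lemma segment_is_arc P Q : P != Q -> is_arc P Q (segment P Q).
Proof.
move=> PQ; exists (line P Q); split => //.
- have cont (a b : R) : continuous (fun t : R => a + t * b).
    move=> t; apply: cvgD; first exact: cvg_cst.
    by apply: cvgM; [exact: cvg_id | exact: cvg_cst].
  by apply: continuous_subspaceT => t; exact: (cvg_pair (cont _ _ t) (cont _ _ t)).
- move=> s t _ _ [].
  move: P Q PQ => [p1 p2] [q1 q2] /= PQ /addrI e1 /addrI e2.
  have [E1|N1] := eqVneq (q1 - p1) 0; last exact: (mulIf N1).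
  have [E2|N2] := eqVneq (q2 - p2) 0; last exact: (mulIf N2).
  by move/eqP: PQ; case; congr pair; lra.
- by rewrite /line !mul0r !addr0; case: P {PQ}.
- by rewrite /line !mul1r !subrKC; case: Q {PQ}.
Qed.

(* The centre sits at (0, 1) and the other vertices on the axis, so that straight
   edges do not cross. *)
Definition fan_point (x : nat) : R * R := if x is 0%N then (0, 1) else (x%:R, 0).

(** The existential orients the edge upwards; a set that is no edge gets the empty arc. *)
Definition fan_arc n r (e : {set fan n r}) : set (R * R) :=
  [set P | exists x y : 'I_n, [/\ fan_up n r x y, e = [set x; y]%SET
                               & segment (fan_point x) (fan_point y) P]].

Lemma fan_point_inj : injective fan_point.
Proof.
case=> [|x] [|y] //= [] /eqP; try by rewrite ?pnatr_eq0 // eq_sym pnatr_eq0.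
by rewrite eqr_nat => /eqP [->].
Qed.

Lemma fan_arcE n r (x y : 'I_n) : fan_up n r x y ->
  fan_arc ([set x; y]%SET : {set fan n r}) = segment (fan_point x) (fan_point y).
Proof.
move=> up; apply/seteqP; split=> [P [u [v [upuv /esym e Puv]]]|P Pxy]; last by exists x, y.
have := set21 x y; have := set22 x y; have := set21 u v; have := set22 u v.
rewrite {1 2}e -{3 4}e !inE => /orP[]/eqP ? /orP[]/eqP ? _ _; subst=> //.
- by have := fan_up_lt upuv; rewrite ltnn.
- by have := fan_up_lt up; have := fan_up_lt upuv; lia.
- by have := fan_up_lt upuv; rewrite ltnn.
Qed.

Lemma fan_arc_cases n r (e : {set fan n r}) P : fan_arc e P ->
  (exists x y t, [/\ (x : 'I_n) = 0%N :> nat, (0 < (y : 'I_n))%N, e = [set x; y]%SET, 0 <= t <= 1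
     & P = (t * y%:R, 1 - t)]) \/
  (exists x y t, [/\ (0 < (x : 'I_n))%N, (y : 'I_n) = x.+1 :> nat, e = [set x; y]%SET, 0 <= t <= 1
     & P = (x%:R + t, 0)]).
Proof.
move=> [x [y [up -> [t /= t01 <-]]]]; have lt_xy := fan_up_lt up.
have {}t01 : 0 <= t <= 1 by move: t01; rewrite in_itv.
have y0 : (0 < y)%N by lia.
have py : fan_point y = (y%:R, 0) by case: (y : nat) y0.
have [x0|x0] := posnP x.
  left; exists x, y, t; split=> //; rewrite py x0 /line /=.
  by congr pair; ring.
right; exists x, y, t.
have xy : (y : nat) = x.+1 by case/orP: up => [/eqP|/and3P[/eqP]] //; lia.
split=> //; have -> : fan_point x = (x%:R, 0) by case: (x : nat) x0.
by rewrite py xy /line -natr1 /=; congr pair; ring.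
Qed.

(** Two spokes at the same height have the same parameter, so away from the apex different feet give
    different points. A spoke meets the axis only at its foot, and axis edges are unit intervals
    that meet only in integers. *)
Lemma planar_fan n r : planar R (fan n r).
Proof.
have point0 (x : 'I_n) : x = 0%N :> nat -> fan_point x = (0, 1) by move=> ->.
have pointS (x : 'I_n) : (0 < x)%N -> fan_point x = (x%:R, 0) by case: (x : nat).
have natS (a b : nat) : (a < b)%N -> a%:R + 1 <= b%:R :> R by rewrite natr1 ler_nat.
exists (fun x : 'I_n => fan_point x), (@fan_arc n r); split.
- by move=> x y /fan_point_inj/val_inj.
- move=> x y xy.
  have ne : fan_point x != fan_point y.
    by apply: contraTneq xy => /fan_point_inj/val_inj ->; rewrite adj_irr.
  case/orP: xy => up; first by rewrite fan_arcE //; apply: segment_is_arc.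
  by rewrite finset.setUC fan_arcE // segmentC; apply: segment_is_arc.
- move=> e z _ /fan_arc_cases[] [x [y [t [x0 y0 -> t01]]]].
    have [z0|z0] := posnP z.
      by move=> _; rewrite !inE; apply/orP; left; apply/eqP/val_inj; rewrite /= x0.
    rewrite (pointS z) // => -[zE tE]; have t1 : t = 1 by lra.
    move: zE; rewrite t1 mul1r => /eqP; rewrite eqr_nat => /eqP zy.
    by rewrite !inE; apply/orP; right; apply/eqP/val_inj.
  have [z0|z0] := posnP z.
    by rewrite (point0 z) // => -[_] /eqP; rewrite oner_eq0.
  rewrite (pointS z) // => -[zE]; rewrite !inE.
  have [zx|zx|zx] := ltngtP z x.
  + by have := natS _ _ zx; lra.
  + have [yz|yz|yz] := ltngtP y z.
    * by have := natS _ _ yz; rewrite y0 -natr1; lra.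
    * by lia.
    * by apply/orP; right; apply/eqP/val_inj.
  + by apply/orP; left; apply/eqP/val_inj.
move=> e e' _ _ ee' P [/fan_arc_cases + /fan_arc_cases].
move=> [] [x [y [t [x0 y0 eE t01 PE]]]] [] [x' [y' [t' [x0' y0' eE' t01' PE']]]].
- have xx : x = x' by apply: val_inj; rewrite /= x0.
  move: PE'; rewrite {1}PE => -[P1 P2]; have tt : t' = t by lra.
  have [t0|t0] := eqVneq t 0.
    by exists x; rewrite /= ?eE ?set21 // PE point0 // t0 mul0r subr0.
  move: P1; rewrite tt => /(mulfI t0)/eqP; rewrite eqr_nat => /eqP yy.
  by case/eqP: ee'; rewrite eE eE' xx (val_inj yy : y = y').
- move: PE'; rewrite {1}PE => -[_ P2]; have t1 : t = 1 by lra.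
  by exists y; rewrite /= ?eE ?set22 // pointS // PE t1 mul1r subrr.
- move: (PE'); rewrite {1}PE => -[P1 P2]; have t1 : t' = 1 by lra.
  move: P1; rewrite t1 mul1r => P1.
  have [yx|yx|yx] := ltngtP y' x.
  + by have := natS _ _ yx; lra.
  + exists y; rewrite /= ?eE ?set22 // pointS ?y0 // PE -natr1.
    by have le := natS _ _ yx; congr pair; lra.
  + exists x; rewrite /= ?eE ?set21 // pointS // PE; congr pair.
    by move: P1; rewrite yx; lra.
- move: PE'; rewrite {1}PE => -[P1].
  have [xx|xx|xx] := ltngtP x x'.
  + exists y; rewrite /= ?eE ?set22 // pointS ?y0 // PE -natr1.
    by have le := natS _ _ xx; congr pair; lra.
  + exists x; rewrite /= ?eE ?set21 // pointS // PE.
    by have le := natS _ _ xx; congr pair; lra.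
  case/eqP: ee'; rewrite eE eE' (val_inj xx : x = x').
  by congr (_ |: _)%SET; congr finset.set1; apply: val_inj; rewrite /= y0 y0' xx.
Qed.
End Planarity.

Theorem corollary1p11 (R : realType) (r : nat) (hr : 2 <= r) :
  (forall n : nat, (exists2 k : nat, 2 <= k & n = k * r) ->
     exists G : sgraph, [/\ in_M r G, #|G| = n & planar R G])
  /\
  (exists F : nat -> sgraph,
     (forall i : nat, in_M r (F i) /\ planar R (F i)) /\
     (forall i j : nat, i <> j -> ~ isomorphic (F i) (F j))).
Proof.
split=> [n [k k2 ->]|].
  by exists (fan (k * r) r); split; [exact: fan_in_M | exact: card_ord | exact: planar_fan].
(* The shift makes every factor at least 2; an isomorphism would equate the vertex numbers. *)
exists (fun i => fan (i.+2 * r) r); split=> [i|i j ij [f /bij_eq_card + _]].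
  by split; [exact: fan_in_M | exact: planar_fan].
rewrite !card_ord => /eqP; rewrite eqn_pmul2r; last by apply: leq_trans hr.
by move=> /eqP [].
Qed.
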